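(* Let $\eta\in Bel(\mathbb{D})$ be infinitesimally uniquely extremal in its infinitesimal class $[\eta]_B$ and have constant modulus, and let $k=\|\eta\|_\infty$ (so $|\eta|=k$ a.e.). Let $\kappa$ be a non-negative measurable function on $\mathbb{D}$ with $\|\kappa\|_\infty\le k$, and put $\mu(z)=\kappa(z)\eta(z)$ for $z\in\mathbb{D}$. Then $\mu$ is infinitesimally non-decreasable in its infinitesimal class $[\mu]_B$.
   Context: $\mathbb{D}$ is the open unit disk. $Bel(\mathbb{D})$ is the Banach space of Beltrami differentials $\mu=\mu(z)\,d\bar z/dz$ on $\mathbb{D}$ (identified with complex-valued measurable functions, up to a.e. equality) with finite $L^\infty$-norm. $Q(\mathbb{D})$ is the Banach space of holomorphic functions $\varphi$ on $\mathbb{D}$ with $\|\varphi\|=\iint_{\mathbb{D}}|\varphi|\,dx\,dy<\infty$. Two elements $\mu,\nu\in Bel(\mathbb{D})$ are infinitesimally equivalent, $\mu\approx\nu$, if $\iint_{\mathbb{D}}\mu\varphi\,dx\,dy=\iint_{\mathbb{D}}\nu\varphi\,dx\,dy$ for all $\varphi\in Q(\mathbb{D})$; $[\mu]_B$ is the equivalence class of $\mu$, and $\|[\mu]_B\|=\inf\{\|\nu\|_\infty:\nu\in[\mu]_B\}$ is the quotient norm. $\mu$ is (infinitesimally) extremal in $[\mu]_B$ if $\|\mu\|_\infty=\|[\mu]_B\|$, and (infinitesimally) uniquely extremal if $\|\nu\|_\infty>\|\mu\|_\infty$ for every other $\nu\in[\mu]_B$. $\mu\in Bel(\mathbb{D})$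 (not necessarily extremal) is infinitesimally non-decreasable in $[\mu]_B$ if, whenever $\nu\in[\mu]_B$ satisfies $|\nu(z)|\le|\mu(z)|$ for a.e. $z\in\mathbb{D}$, then $\nu=\mu$ a.e. *)

(* Defs.v *)
From mathcomp Require Import all_boot all_order all_algebra.
From mathcomp Require Import complex.
From mathcomp Require Import all_classical all_reals all_analysis. 
From mathcomp Require Import ess_sup_inf.

Set Implicit Arguments.
Unset Strict Implicit.
Unset Printing Implicit Defensive.

Import Order.TTheory GRing.Theory Num.Theory.
Import numFieldNormedType.Exports.

Local Open Scope classical_set_scope.
Local Open Scope ring_scope.
Local Open Scope complex_scope.

(* Functions on the unit disk are total functions on R[i]; every notion below
   looks only at their values on the disk. *)
Definition unit_disk (R : realType) : set R[i] :=
  [set z | Normc.normc z < 1].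

(* R[i] carries no measurable structure in the library: measure-theoretic
   notions are expressed in the real coordinates (x, y) of z = x + iy. *)
Definition of_xy (R : realType) (p : R * R) : R[i] := p.1 +i* p.2.

Definition disk_xy (R : realType) : set (R * R) :=
  @of_xy R @^-1` @unit_disk R.

Notation area R := (@lebesgue_measure R \x @lebesgue_measure R)%E.

Definition ae_disk (R : realType) (P : R[i] -> Prop) : Prop :=
  {ae area R, forall p, disk_xy p -> P (of_xy p)}.

Definition disk_measurable (R : realType) (f : R[i] -> R[i]) : Prop :=
  measurable_fun (@disk_xy R) (fun p => complex.Re (f (of_xy p))) /\
  measurable_fun (@disk_xy R) (fun p => complex.Im (f (of_xy p))).

(* Extending |f| by 0 off the disk does not affect the essential supremum
   over the disk, because |f| >= 0. *)
Definition Linfty_norm (R : realType) (f : R[i] -> R[i]) : \bar R :=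
  ess_sup (area R) ((fun p => (Normc.normc (f (of_xy p)))%:E) \_ (@disk_xy R)).

Definition disk_integral (R : realType) (f : R[i] -> R[i]) : R[i] :=
  (\int[area R]_(p in @disk_xy R) complex.Re (f (of_xy p))) +i*
  (\int[area R]_(p in @disk_xy R) complex.Im (f (of_xy p))).

Definition Bel (R : realType) : set (R[i] -> R[i]) :=
  [set mu | disk_measurable mu /\ (Linfty_norm mu < +oo)%E].

(* Differentiability over the field R[i] itself, i.e. complex
   differentiability. *)
Definition holomorphic_on_disk (R : realType) (phi : R[i] -> R[i]) : Prop :=
  forall z, unit_disk z -> derivable (phi : R[i]^o -> R[i]^o) z 1.

Definition Q (R : realType) : set (R[i] -> R[i]) :=
  [set phi | holomorphic_on_disk phi /\
    (\int[area R]_(p in @disk_xy R) (Normc.normc (phi (of_xy p)))%:E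
       < +oo)%E].

Definition inf_equiv (R : realType) (mu nu : R[i] -> R[i]) : Prop :=
  forall phi, Q phi ->
    disk_integral (fun z => mu z * phi z) =
    disk_integral (fun z => nu z * phi z).

Definition inf_class (R : realType) (mu : R[i] -> R[i]) :
    set (R[i] -> R[i]) :=
  [set nu | Bel nu /\ inf_equiv mu nu].

Definition inf_uniquely_extremal (R : realType) (mu : R[i] -> R[i]) : Prop :=
  forall nu, inf_class mu nu -> ~ ae_disk (fun z => nu z = mu z) ->
    (Linfty_norm mu < Linfty_norm nu)%E.

Definition inf_nondecreasable (R : realType) (mu : R[i] -> R[i]) : Prop :=
  forall nu, inf_class mu nu ->
    ae_disk (fun z => Normc.normc (nu z) <= Normc.normc (mu z)) ->
    ae_disk (fun z => nu z = mu z).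

Definition constant_modulus (R : realType) (mu : R[i] -> R[i]) : Prop :=
  exists c : R, ae_disk (fun z => Normc.normc (mu z) = c).

(* Main.v *)
Require Import Defs.
From mathcomp Require Import all_boot all_order all_algebra.
From mathcomp Require Import complex.
From mathcomp Require Import all_classical all_reals all_analysis.
From mathcomp Require Import measurable_realfun ess_sup_inf ring lra.

Set Implicit Arguments.
Unset Strict Implicit.
Unset Printing Implicit Defensive.

Import Order.TTheory GRing.Theory Num.Theory.
Import numFieldNormedType.Exports.

Local Open Scope classical_set_scope.
Local Open Scope ring_scope.
Local Open Scope complex_scope.

(** Suppose that [nu] is infinitesimally equivalent to [mu = kappa eta] and
    that [|nu| <= |mu|] almost everywhere.  Transport the difference to [eta]:
    for a small constant [t > 0] put
      [eta_t = eta + t (nu - mu) = (1 - t kappa) eta + t nu].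
    Pairing with [Q] is linear, so [eta_t] is infinitesimally equivalent to
    [eta] ([inf_class_perturb]).  As soon as [t kappa <= 1], for which
    [t = 1 / (1 + |k|)] is enough, the second expression gives
      [|eta_t| <= (1 - t kappa) |eta| + t kappa |eta| = |eta|]
    ([normc_interpolation]), so [eta_t] has no larger norm than [eta].  Unique
    extremality forces [eta_t = eta], that is [nu = mu], almost everywhere.

    Linearity of the pairing rests on the integrability of [f phi] for a
    bounded [f] and a [phi] in [Q] ([Bel_mul_Q_integrable]).  This in turn
    needs holomorphic functions to be measurable for the product sigma-algebra
    of the plane ([holomorphic_disk_measurable]), which follows from their
    continuity once open subsets of the plane are known to belong to that
    sigma-algebra ([open_measurable_prod]). *)

Section bel_disk.
Context {R : realType}.

(** * Borel sets of the plane *)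

(** The plane is second countable: an open set is the union of the squares
    with rational centre and rational radius that it contains, and those are
    measurable rectangles. *)
Lemma open_measurable_prod (A : set (R * R)) : open A -> measurable A.
Proof.
move=> oA.
pose box (q : rat * rat * rat) : set (R * R) :=
  ball (ratr q.1.1 : R) (ratr q.2 : R) `*` ball (ratr q.1.2 : R) (ratr q.2).
have -> : A = \bigcup_q (if `[< box q `<=` A >] then box q else set0).
  apply/seteqP; split => [[x y] Axy|p [q _]]; last first.
    by case: asboolP => // + pq; exact.
  move: (open_nbhs_nbhs (conj oA Axy)) => /nbhs_ballP[e /= e0 eA].
  have [s] := rat_in_itvoo (divr_gt0 e0 (ltr0Sn R 1)).
  rewrite in_itv/= => /andP[s0 se].
  have [a] : exists a : rat, ratr a \in `]x - ratr s, (x + ratr s : R)[.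
    by apply: rat_in_itvoo; lra.
  have [b] : exists a : rat, ratr a \in `]y - ratr s, (y + ratr s : R)[.
    by apply: rat_in_itvoo; lra.
  rewrite !in_itv /= => /andP[b1 b2] /andP[a1 a2].
  exists (a, b, s) => //; rewrite asboolT.
    by split; rewrite /ball /= ltr_norml; apply/andP; split; lra.
  move=> [u v] [] /=; rewrite /ball /= !ltr_norml => /andP[u1 u2] /andP[v1 v2].
  by apply: eA; split; rewrite /ball /= ltr_norml; apply/andP; split; lra.
apply: countable_bigcupT_measurable => [|q]; first exact: countableP.
case: asboolP => // _.
by apply: measurableX; apply: open_measurable; exact: ball_open.
Qed.

Lemma continuous_measurable_prod (D : set (R * R)) (f : R * R -> R) :
  open D -> (forall p, D p -> {for p, continuous f}) -> measurable_fun D f.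
Proof.
move=> oD cf mD; apply: (measurability _ (RGenOpens.measurableE R)) => //.
move=> _ [_ [a [b ->] <-]]; apply: open_measurable_prod.
rewrite openE => p [Dp fp]; apply: filterI; first exact: open_nbhs_nbhs.
exact: (cf p Dp _ (open_nbhs_nbhs (conj (interval_open _ _) fp))).
Qed.

(** * The complex modulus *)

Lemma normc_real (x : R) : Normc.normc x%:C = `|x|.
Proof. by rewrite /= expr0n addr0 sqrtr_sqr. Qed.

Lemma normc_imag (y : R) : Normc.normc (0 +i* y) = `|y|.
Proof. by rewrite /= expr0n add0r sqrtr_sqr. Qed.

Lemma normc_triangle (z w : R[i]) :
  Normc.normc (z + w) <= Normc.normc z + Normc.normc w.
Proof. exact: le_normcD. Qed.

Lemma Re_le_normc (z : R[i]) : `|complex.Re z| <= Normc.normc z.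
Proof.
by case: z => a b /=; rewrite -sqrtr_sqr ler_wsqrtr// lerDl sqr_ge0.
Qed.

Lemma Im_le_normc (z : R[i]) : `|complex.Im z| <= Normc.normc z.
Proof.
by case: z => a b /=; rewrite -sqrtr_sqr ler_wsqrtr// lerDr sqr_ge0.
Qed.

Lemma normc_ge0 (z : R[i]) : 0 <= Normc.normc z.
Proof. by case: z => a b; exact: sqrtr_ge0. Qed.

(** The left-hand side is the modulus of [(1 - t c) e + t n], a combination
    with nonnegative coefficients of [e] and of a number of modulus at most
    [c |e|]. *)
Lemma normc_interpolation (t c : R) (e n : R[i]) :
  0 <= t -> 0 <= c -> t * c <= 1 ->
  Normc.normc n <= Normc.normc (c%:C * e) ->
  Normc.normc (e + t%:C * (n - c%:C * e)) <= Normc.normc e.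
Proof.
move=> t0 c0 tc; rewrite Normc.normcM normc_real ger0_norm // => nle.
have -> : e + t%:C * (n - c%:C * e) = (1 - t * c)%:C * e + t%:C * n.
  by rewrite rmorphB rmorphM rmorph1 /=; ring.
apply: le_trans (normc_triangle _ _) _.
rewrite !Normc.normcM !normc_real !ger0_norm ?subr_ge0//.
by have := ler_wpM2l t0 nle; lra.
Qed.

(** * Measurable functions on the disk *)

Lemma of_xy_continuous : continuous (@of_xy R : R * R -> R[i]^o).
Proof.
(* The radius [e +i* e'] lives in [R[i]]; being positive, it is real. *)
move=> p; apply/cvgrPdist_lt => -[e e'].
rewrite ltcE /= => /andP[/eqP -> e0].
apply: filterS (nbhsx_ballx p (e / 2) (divr_gt0 e0 (ltr0Sn R 1))) => q [].
rewrite /ball /= => q1 q2.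
change ((Normc.normc (of_xy p - of_xy q))%:C < e%:C); rewrite ltcR.
have -> : of_xy p - of_xy q = (p.1 - q.1)%:C + (0 +i* (p.2 - q.2)).
  by apply/eqP; rewrite eq_complex /= addr0 add0r !eqxx.
apply: le_lt_trans (normc_triangle _ _) _; rewrite normc_real normc_imag.
lra.
Qed.

(** Stated for an additive map so that it serves both the real and the
    imaginary part. *)
Lemma normc_contraction_continuous (f : {additive R[i] -> R}) :
  (forall z, `|f z| <= Normc.normc z) -> continuous (f : R[i]^o -> R).
Proof.
move=> fle z.
apply/(@cvgrPdist_lt R R^o _ _ (nbhs_filter (z : R[i]^o))) => /= e e0.
have e0C : 0 < e%:C by rewrite ltcR.
apply: filterS (nbhsx_ballx (z : R[i]^o) _ e0C) => w zw.
by rewrite -raddfB; apply: le_lt_trans (fle _) _; rewrite -ltcR.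
Qed.

Lemma open_disk_xy : open (@disk_xy R).
Proof.
have -> : @disk_xy R =
    (fun p : R * R => Num.sqrt (p.1 ^+ 2 + p.2 ^+ 2)) @^-1` `]-oo, 1[.
  by apply/seteqP; split => p; rewrite /= in_itv.
apply: open_comp; last exact: interval_open.
move=> p _; apply: continuous_comp; last exact: sqrt_continuous.
apply: continuousD.
  apply: (continuous_comp (f := fst) (g := fun x : R => x ^+ 2)).
    exact: cvg_fst.
  exact: exprn_continuous.
apply: (continuous_comp (f := snd) (g := fun x : R => x ^+ 2)).
  exact: cvg_snd.
exact: exprn_continuous.
Qed.

Lemma measurable_disk_xy : measurable (@disk_xy R).
Proof. by apply: open_measurable_prod; exact: open_disk_xy. Qed.

(** Complex differentiability gives continuity, and continuity on an open set
    gives measurability. *)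
Lemma holomorphic_disk_measurable (phi : R[i] -> R[i]) :
  holomorphic_on_disk phi -> disk_measurable phi.
Proof.
move=> hphi.
have cphi p : disk_xy p ->
    {for p, continuous (fun q => phi (of_xy q) : R[i]^o)}.
  move=> Dp.
  apply: (@continuous_comp (R * R)%type R[i]^o R[i]^o (@of_xy R) phi).
    exact: of_xy_continuous.
  by apply/differentiable_continuous/derivable1_diffP; exact: hphi.
split; apply: continuous_measurable_prod open_disk_xy _ => p Dp.
  apply: (continuous_comp (cphi _ Dp)).
  exact: (normc_contraction_continuous Re_le_normc).
apply: (continuous_comp (cphi _ Dp)).
exact: (normc_contraction_continuous Im_le_normc).
Qed.

Lemma disk_measurable_cst (c : R[i]) : disk_measurable (fun=> c).
Proof. by split; exact: measurable_cst. Qed.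

Lemma disk_measurableD (f g : R[i] -> R[i]) :
  disk_measurable f -> disk_measurable g ->
  disk_measurable (fun z => f z + g z).
Proof.
move=> [fr fi] [gr gi]; split.
  by apply: eq_measurable_fun (measurable_funD fr gr) => p _; rewrite raddfD.
by apply: eq_measurable_fun (measurable_funD fi gi) => p _; rewrite raddfD.
Qed.

Lemma disk_measurableM (f g : R[i] -> R[i]) :
  disk_measurable f -> disk_measurable g ->
  disk_measurable (fun z => f z * g z).
Proof.
move=> [fr fi] [gr gi]; split.
  apply: eq_measurable_fun
    (measurable_funB (measurable_funM fr gr) (measurable_funM fi gi)) => p _ /=.
  by case: (f _) (g _) => ? ? [].
apply: eq_measurable_fun
  (measurable_funD (measurable_funM fr gi) (measurable_funM fi gr)) => p _ /=.
by case: (f _) (g _) => ? ? [].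
Qed.

Lemma disk_measurable_normc (f : R[i] -> R[i]) : disk_measurable f ->
  measurable_fun (@disk_xy R) (fun p => Normc.normc (f (of_xy p))).
Proof.
move=> [fr fi].
have := measurableT_comp (continuous_measurable_fun (@sqrt_continuous R))
  (measurable_funD (measurable_funM fr fr) (measurable_funM fi fi)).
by apply: eq_measurable_fun => p _ /=; case: (f _) => a b /=; rewrite !expr2.
Qed.

(** * The essential supremum norm *)

(** With this instance the general lemmas on filters let almost everywhere
    statements on the disk be combined pointwise, away from the coordinates. *)
#[global] Instance ae_disk_filter : Filter (@ae_disk R).
Proof.
have [FT FI FS] := ae_filter_ringOfSetsType (area R).
split=> [|P Q aP aQ|P Q PQ]; rewrite /ae_disk.
- by apply: FS FT.
- by apply: FS (FI _ _ aP aQ) => p [pP pQ] Dp; split; [exact: pP|exact: pQ].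
- by apply: FS => p pP Dp; exact/PQ/pP.
Qed.

Lemma ae_le_Linfty_norm (f : R[i] -> R[i]) (M : R) :
  (Linfty_norm f <= M%:E)%E -> ae_disk (fun z => Normc.normc (f z) <= M).
Proof.
move=> /ess_supP; apply: filterS => p + Dp.
by rewrite patchE mem_set // lee_fin.
Qed.

(** Off the disk [Linfty_norm] sees the value [0], hence the sign condition on
    the bound. *)
Lemma Linfty_norm_le (f : R[i] -> R[i]) (M : R) : 0 <= M ->
  ae_disk (fun z => Normc.normc (f z) <= M) -> (Linfty_norm f <= M%:E)%E.
Proof.
have [_ _ aeS] := ae_filter_ringOfSetsType (area R).
move=> M0 fM; apply/ess_supP; apply: aeS fM => p.
by rewrite patchE; case: ifPn => [/set_mem Dp /(_ Dp)|_ _]; rewrite lee_fin.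
Qed.

Lemma le_Linfty_norm (f g : R[i] -> R[i]) :
  ae_disk (fun z => Normc.normc (f z) <= Normc.normc (g z)) ->
  (Linfty_norm f <= Linfty_norm g)%E.
Proof.
have [_ _ aeS] := ae_filter_ringOfSetsType (area R).
move=> fg; apply: le_ess_sup; apply: aeS fg => p.
by rewrite !patchE; case: ifPn => [/set_mem Dp /(_ Dp)|_ _]; rewrite ?lee_fin.
Qed.

Lemma Bel_ae_bounded (f : R[i] -> R[i]) : Bel f ->
  exists2 M : R, 0 <= M & ae_disk (fun z => Normc.normc (f z) <= M).
Proof.
move=> [_ foo]; exists (Num.max 0 (fine (Linfty_norm f))).
  by rewrite le_max lexx.
apply: ae_le_Linfty_norm; case: (Linfty_norm f) foo => [r| |] //= _.
  by rewrite lee_fin le_max lexx orbT.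
exact: leNye.
Qed.

Lemma Bel_of_bounded (f : R[i] -> R[i]) (M : R) : disk_measurable f ->
  0 <= M -> ae_disk (fun z => Normc.normc (f z) <= M) -> Bel f.
Proof.
move=> mf M0 fM; split=> //.
by apply: le_lt_trans (Linfty_norm_le M0 fM) _; rewrite ltry.
Qed.

Lemma BelD (f g : R[i] -> R[i]) : Bel f -> Bel g -> Bel (fun z => f z + g z).
Proof.
move=> Bf Bg; have [M M0 fM] := Bel_ae_bounded Bf.
have [N N0 gN] := Bel_ae_bounded Bg.
apply: (@Bel_of_bounded _ (M + N)).
- exact: disk_measurableD (proj1 Bf) (proj1 Bg).
- exact: addr_ge0.
apply: filterS2 fM gN => z fM gN.
by apply: le_trans (normc_triangle _ _) _; exact: lerD.
Qed.

Lemma BelZ (c : R[i]) (f : R[i] -> R[i]) : Bel f -> Bel (fun z => c * f z).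
Proof.
move=> Bf; have [M M0 fM] := Bel_ae_bounded Bf.
apply: (@Bel_of_bounded _ (Normc.normc c * M)).
- exact: disk_measurableM (disk_measurable_cst c) (proj1 Bf).
- by rewrite mulr_ge0 ?normc_ge0.
- by apply: filterS fM => z fM; rewrite Normc.normcM ler_wpM2l ?normc_ge0.
Qed.

(** * The pairing with integrable holomorphic functions *)

Lemma ae_dominated_integrable d (T : measurableType d)
    (mu : {measure set T -> \bar R}) (D : set T) (f g : T -> R) (M : R) :
  measurable D -> measurable_fun D f -> measurable_fun D g ->
  0 <= M -> (forall x, D x -> 0 <= g x) ->
  {ae mu, forall x, D x -> `|f x| <= M * g x} ->
  (\int[mu]_(x in D) (g x)%:E < +oo)%E -> mu.-integrable D (EFin \o f).
Proof.
move=> mD mf mg M0 g0 fg goo; apply/integrableP.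
split; first exact/measurable_EFinP.
apply: (@le_lt_trans _ _ (\int[mu]_(x in D) (M%:E * (g x)%:E))%E).
  apply: ae_ge0_le_integral => //.
  - by apply: measurableT_comp => //; exact/measurable_EFinP.
  - by move=> x Dx; rewrite -EFinM lee_fin mulr_ge0 ?g0.
  - by apply: measurable_funeM; exact/measurable_EFinP.
rewrite ge0_integralZl_EFin //; last exact/measurable_EFinP.
by apply: lte_mul_pinfty; rewrite ?lee_fin.
Qed.

Definition disk_integrable (f : R[i] -> R[i]) : Prop :=
  (area R).-integrable (@disk_xy R)
    (EFin \o (fun p => complex.Re (f (of_xy p)))) /\
  (area R).-integrable (@disk_xy R)
    (EFin \o (fun p => complex.Im (f (of_xy p)))).

(** The pairing of the infinitesimal equivalence is an absolutely convergent
    integral: the modulus of the integrand is dominated almost everywhere by a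
    multiple of the integrable function [|phi|]. *)
Lemma Bel_mul_Q_integrable (f phi : R[i] -> R[i]) : Bel f -> Q phi ->
  disk_integrable (fun z => f z * phi z).
Proof.
move=> Bf [hphi phioo]; have [M M0 fM] := Bel_ae_bounded Bf.
have mphi := holomorphic_disk_measurable hphi.
have [mr mi] := disk_measurableM (proj1 Bf) mphi.
have mn := disk_measurable_normc mphi.
have mD := measurable_disk_xy.
have fphiM : ae_disk (fun z =>
    Normc.normc (f z * phi z) <= M * Normc.normc (phi z)).
  by apply: filterS fM => z fM; rewrite Normc.normcM ler_wpM2r ?normc_ge0.
have fphiRe : ae_disk (fun z =>
    `|complex.Re (f z * phi z)| <= M * Normc.normc (phi z)).
  by apply: filterS fphiM => z; exact/le_trans/Re_le_normc.
have fphiIm : ae_disk (fun z =>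
    `|complex.Im (f z * phi z)| <= M * Normc.normc (phi z)).
  by apply: filterS fphiM => z; exact/le_trans/Im_le_normc.
have n0 p : disk_xy p -> 0 <= Normc.normc (phi (of_xy p)).
  by move=> _; exact: normc_ge0.
split.
  exact: (ae_dominated_integrable (mu := area R) mD mr mn M0 n0 fphiRe phioo).
exact: (ae_dominated_integrable (mu := area R) mD mi mn M0 n0 fphiIm phioo).
Qed.

Lemma disk_integralD (f g : R[i] -> R[i]) :
  disk_integrable f -> disk_integrable g ->
  disk_integral (fun z => f z + g z) = disk_integral f + disk_integral g.
Proof.
move=> [fr fi] [gr gi]; have mD := measurable_disk_xy.
apply/eqP; rewrite eq_complex /=; apply/andP; split; apply/eqP.
  rewrite -(RintegralD (mu := area R) mD fr gr).
  by apply: eq_Rintegral => p _; rewrite raddfD.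
rewrite -(RintegralD (mu := area R) mD fi gi).
by apply: eq_Rintegral => p _; rewrite raddfD.
Qed.

Lemma disk_integralZ (t : R) (f : R[i] -> R[i]) : disk_integrable f ->
  disk_integral (fun z => t%:C * f z) = t%:C * disk_integral f.
Proof.
move=> [fr fi]; have mD := measurable_disk_xy.
apply/eqP; rewrite eq_complex /= !mul0r subr0 addr0.
apply/andP; split; apply/eqP.
  rewrite -(RintegralZl (mu := area R) t mD fr); apply: eq_Rintegral => p _.
  by case: (f _) => a b /=; rewrite mul0r subr0.
rewrite -(RintegralZl (mu := area R) t mD fi); apply: eq_Rintegral => p _.
by case: (f _) => a b /=; rewrite mul0r addr0.
Qed.

Lemma disk_integralB (f g : R[i] -> R[i]) :
  disk_integrable f -> disk_integrable g ->
  disk_integral (fun z => f z - g z) = disk_integral f - disk_integral g.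
Proof.
move=> [fr fi] [gr gi]; have mD := measurable_disk_xy.
apply/eqP; rewrite eq_complex /=; apply/andP; split; apply/eqP.
  rewrite -(RintegralB (mu := area R) mD fr gr).
  by apply: eq_Rintegral => p _; rewrite raddfB.
rewrite -(RintegralB (mu := area R) mD fi gi).
by apply: eq_Rintegral => p _; rewrite raddfB.
Qed.

(** An infinitesimally trivial difference may be added to any other Beltrami
    differential with an arbitrary real weight, because the elements that pair
    to zero with [Q] form a linear subspace. *)
Lemma inf_class_perturb (eta mu nu : R[i] -> R[i]) (t : R) :
  Bel eta -> Bel mu -> inf_class mu nu ->
  inf_class eta (fun z => eta z + t%:C * (nu z - mu z)).
Proof.
move=> Beta Bmu [Bnu munu].
have Bd : Bel (fun z => nu z - mu z).
  have := BelD Bnu (BelZ (-1)%:C Bmu); congr Bel; apply/funext => z.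
  by rewrite rmorphN1 mulN1r.
split; first exact: BelD Beta (BelZ _ Bd).
move=> phi Qphi.
have d0 : disk_integral (fun z => (nu z - mu z) * phi z) = 0.
  under [X in disk_integral X]eq_fun do rewrite mulrBl.
  rewrite disk_integralB; [|exact: Bel_mul_Q_integrable..].
  by rewrite (munu phi Qphi) subrr.
under [X in _ = disk_integral X]eq_fun do rewrite mulrDl.
rewrite disk_integralD; [|exact: Bel_mul_Q_integrable|].
  under [X in _ = _ + disk_integral X]eq_fun do rewrite -mulrA.
  by rewrite disk_integralZ ?d0 ?mulr0 ?addr0//; exact: Bel_mul_Q_integrable.
exact: Bel_mul_Q_integrable (BelZ _ Bd) Qphi.
Qed.

End bel_disk.

Theorem theorem4p3 (R : realType) (eta : R[i] -> R[i]) (k : R)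
    (kappa : R[i] -> R)
    (eta_Bel : Bel eta)
    (eta_extremal : inf_uniquely_extremal eta)
    (eta_modulus : constant_modulus eta)
    (kE : Linfty_norm eta = k%:E)
    (kappa_measurable : disk_measurable (fun z => (kappa z)%:C))
    (kappa_ge0 : forall z, unit_disk z -> 0 <= kappa z)
    (kappa_le : (Linfty_norm (fun z => (kappa z)%:C) <= k%:E)%E) :
  let mu := fun z => (kappa z)%:C * eta z in
  Bel mu /\ inf_nondecreasable mu.
Proof.
move=> mu.
have kappaP : ae_disk (fun z => 0 <= kappa z <= k).
  have : ae_disk (fun z => 0 <= kappa z) by apply: aeW => p; exact: kappa_ge0.
  apply: filterS2 (ae_le_Linfty_norm kappa_le) => z.
  by rewrite normc_real => + k0; rewrite ger0_norm // k0.
have Bmu : Bel mu.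
  apply: (@Bel_of_bounded _ _ (k * k)).
  - exact: disk_measurableM kappa_measurable (proj1 eta_Bel).
  - by rewrite -expr2 sqr_ge0.
  - have etak : ae_disk (fun z => Normc.normc (eta z) <= k).
      by apply: ae_le_Linfty_norm; rewrite kE.
    apply: filterS2 kappaP etak => z /andP[k0 kk] ek.
    by rewrite Normc.normcM normc_real ger0_norm // ler_pM ?normc_ge0.
split=> // nu munu nule.
(* The [1 +] keeps [t] positive when [k] is [0]. *)
pose t := (1 + `|k|)^-1.
have t0 : 0 < t by rewrite invr_gt0 ltr_wpDr.
have tkappa z : 0 <= kappa z <= k -> t * kappa z <= 1.
  move=> /andP[_ kk]; rewrite mulrC ler_pdivrMr ?ltr_wpDr// mul1r.
  by rewrite (le_trans kk)// (le_trans (ler_norm k))// lerDr.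
pose eta_t z := eta z + t%:C * (nu z - mu z).
have eta_t_le : ae_disk (fun z => Normc.normc (eta_t z) <= Normc.normc (eta z)).
  apply: filterS2 kappaP nule => z kz; apply: normc_interpolation.
  - exact: ltW.
  - by case/andP: kz.
  - exact: tkappa.
have eta_tE : ae_disk (fun z => eta_t z = eta z).
  apply: contrapT => /(eta_extremal _ (inf_class_perturb t eta_Bel Bmu munu)).
  by apply/negP; rewrite -leNgt; exact: le_Linfty_norm.
have tC0 : t%:C != 0 :> R[i] by rewrite eq_complex /= eqxx andbT gt_eqF.
apply: filterS eta_tE => z etz.
have /eqP : t%:C * (nu z - mu z) = 0 by apply: (addrI (eta z)); rewrite addr0.
by rewrite mulf_eq0 (negPf tC0) subr_eq0 => /eqP.
Qed.
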